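(* Consider a discounted constrained MDP satisfying the Slater condition with constant $\xi>0$. Fix $\rho\in\Delta_S$ and replace the constraint $V_g^\pi(\rho)\ge b$ of the constrained problem by $V_g^\pi(\rho)\ge\bar b$, where $\bar b=b+\delta$ for some $\delta>0$. For $\epsilon<\xi/2$, there exists $\delta=\Theta(\epsilon)$ such that if $T=\Omega(1/\epsilon^2)$, $\eta_1=2\log|A|$ and $\eta_2=2(1-\gamma)/\sqrt T$, then the iterates $\{\pi^{(t)}\}_{t=0}^{T-1}$ generated by the softmax NPG-PD algorithm (see context) satisfy $$\frac1T\sum_{t=0}^{T-1}\big(V_r^\star(\rho)-V_r^{(t)}(\rho)\big)=O(\epsilon),\qquad\Big[\frac1T\sum_{t=0}^{T-1}\big(b-V_g^{(t)}(\rho)\big)\Big]_+\le0.$$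
   Context: Constrained MDP: $S$, $A$ finite state and action spaces; $P(s'\mid s,a)$ transition probabilities; $r,g:S\times A\to[0,1]$ reward and utility; $\gamma\in[0,1)$; $b\in(0,1/(1-\gamma)]$; $\rho\in\Delta_S$ initial state distribution ($\Delta_X$ is the set of probability distributions on $X$). A policy is $\pi:S\to\Delta_A$; $\Pi$ is the set of all policies. For $\diamond\in\{r,g\}$: $V_\diamond^\pi(s)=\mathbb E[\sum_{t\ge0}\gamma^t\diamond(s_t,a_t)\mid\pi,s_0=s]$, $Q_\diamond^\pi(s,a)=\mathbb E[\sum_{t\ge0}\gamma^t\diamond(s_t,a_t)\mid\pi,s_0=s,a_0=a]$, $A_\diamond^\pi(s,a)=Q_\diamond^\pi(s,a)-V_\diamond^\pi(s)$, $V_\diamond^\pi(\rho)=\mathbb E_{s\sim\rho}[V_\diamond^\pi(s)]$. Constrained problem: maximize $V_r^\pi(\rho)$ over $\pi\in\Pi$ subject to $V_g^\pi(\rho)\ge b$; $V_r^\star(\rho)$ is its optimal value (with the original offset $b$). Slater condition with constant $\xi>0$: some $\bar\pi\in\Pi$ has $V_g^{\bar\pi}(\rho)-b\ge\xi$. $[x]_+=\max(x,0)$. The symbols $\Theta,\Omega,O$ hide problem-dependent constants that do not depend on $\epsilon$ or $T$. Softmax NPG-PD algorithm (natural policy gradient primal-dual), applied to the problem with offset $\bar b$: $\pi_\theta(a\mid s)=\exp(\theta_{s,a})/\sum_{a'}\exp(\theta_{s,a'})$, $\theta\in\mathbb R^{|S||A|}$; $\pi^{(t)}=\pi_{\theta^{(t)}}$,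 superscript $(t)$ means evaluated at $\pi^{(t)}$; with $\mathcal P_\Lambda$ the projection onto $\Lambda=[0,2/((1-\gamma)\xi)]$, $$\theta^{(t+1)}_{s,a}=\theta^{(t)}_{s,a}+\frac{\eta_1}{1-\gamma}\big(A_r^{(t)}(s,a)+\lambda^{(t)}A_g^{(t)}(s,a)\big),\qquad\lambda^{(t+1)}=\mathcal P_\Lambda\big(\lambda^{(t)}-\eta_2(V_g^{(t)}(\rho)-\bar b)\big).$$ *)

(* Defs.v *)
From HB Require Import structures.
From mathcomp Require Import all_boot all_order all_algebra.
From mathcomp Require Import all_classical all_reals all_analysis.
From mathcomp Require Import lra.

Set Implicit Arguments.
Unset Strict Implicit.
Unset Printing Implicit Defensive.

Import Order.TTheory GRing.Theory Num.Theory.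
Import numFieldNormedType.Exports.

Local Open Scope classical_set_scope.
Local Open Scope ring_scope.

Definition is_dist (R : realType) (X : finType) (p : X -> R) : Prop :=
  (forall x, 0 <= p x) /\ \sum_(x : X) p x = 1.

Record cmdp (R : realType) (S A : finType) := CMDP {
  trans : S -> A -> S -> R; (* trans s a s' is P(s' | s, a) *)
  reward : S -> A -> R;
  utility : S -> A -> R;
  discount : R;
  offset : R;
  init : S -> R;
  trans_dist : forall s a, is_dist (trans s a);
  reward_bound : forall s a, 0 <= reward s a <= 1;
  utility_bound : forall s a, 0 <= utility s a <= 1;
  discount_bound : 0 <= discount < 1;
  offset_bound : 0 < offset <= (1 - discount)^-1;
  init_dist : is_dist init
}.

Section Values.
Variables (R : realType) (S A : finType) (M : cmdp R S A).

Definition is_policy (pi : S -> A -> R) : Prop := forall s, is_dist (pi s).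

(* A trajectory of length n.+1 is the tuple (s_0,a_0), ..., (s_n,a_n); its
   probability when (s_0,a_0) has law mu and pi is followed afterwards. *)
Definition traj_prob (pi : S -> A -> R) (mu : S * A -> R) (n : nat)
    (w : n.+1.-tuple (S * A)) : R :=
  mu (tnth w ord0) *
  \prod_(t < n)
    (let x := tnth w (inord t) in let y := tnth w (inord t.+1) in
     trans M x.1 x.2 y.1 * pi y.1 y.2).

Definition return_upto (f : S -> A -> R) (n : nat)
    (w : n.+1.-tuple (S * A)) : R :=
  \sum_(t < n.+1) discount M ^+ t * f (tnth w t).1 (tnth w t).2.

(* The expected infinite-horizon discounted return, as the limit of the
   expected returns of the trajectories truncated at a finite horizon. *)
Definition expected_return (pi : S -> A -> R) (f : S -> A -> R)
    (mu : S * A -> R) : R :=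
  limn (fun n : nat =>
    \sum_(w : n.+1.-tuple (S * A)) traj_prob pi mu w * return_upto f w).

Definition V_value (f : S -> A -> R) (pi : S -> A -> R) (s : S) : R :=
  expected_return pi f (fun x => (x.1 == s)%:R * pi x.1 x.2).

Definition Q_value (f : S -> A -> R) (pi : S -> A -> R) (s : S) (a : A) : R :=
  expected_return pi f (fun x => (x == (s, a))%:R).

Definition advantage (f : S -> A -> R) (pi : S -> A -> R) (s : S) (a : A) : R :=
  Q_value f pi s a - V_value f pi s.

Definition V_init (f : S -> A -> R) (pi : S -> A -> R) : R :=
  \sum_(s : S) init M s * V_value f pi s.

Definition slater (xi : R) : Prop :=
  exists pi : S -> A -> R,
    is_policy pi /\ xi <= V_init (utility M) pi - offset M.

Definition optimal_value : R :=
  sup [set V_init (reward M) pi | pi in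
        [set pi | is_policy pi /\ offset M <= V_init (utility M) pi]].

Definition softmax (theta : S -> A -> R) (s : S) (a : A) : R :=
  expR (theta s a) / \sum_(a' : A) expR (theta s a').

Definition dual_bound (xi : R) : R := 2 / ((1 - discount M) * xi).

(* Projection of x onto [0, u], for 0 <= u. *)
Definition proj_itv0 (u x : R) : R := Num.min (Num.max x 0) u.

Lemma proj_itv0P (u x : R) : 0 <= u ->
  0 <= proj_itv0 u x <= u /\
  forall y : R, 0 <= y <= u -> `|x - proj_itv0 u x| <= `|x - y|.
Proof.
move=> u0; rewrite /proj_itv0; split.
  by rewrite le_min ge_min le_max !lexx u0 !orbT.
move=> y /andP[y0 yu]; case: (leP x 0) => x0.
  rewrite (min_idPl u0) subr0.
  by rewrite ler0_norm // ler0_norm; lra.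
case: (leP x u) => xu; first by rewrite subrr normr0.
by rewrite !ger0_norm; lra.
Qed.

(* The pair (theta^(t), lambda^(t)) for the constraint V_g >= bbar. *)
Fixpoint npgpd (xi bbar eta1 eta2 : R) (theta0 : S -> A -> R) (lambda0 : R)
    (t : nat) : (S -> A -> R) * R :=
  if t is t'.+1 then
    let: (theta, lambda) :=
      npgpd xi bbar eta1 eta2 theta0 lambda0 t' in
    let pi := softmax theta in
    (fun s a => theta s a + eta1 / (1 - discount M) *
       (advantage (reward M) pi s a + lambda * advantage (utility M) pi s a),
     proj_itv0 (dual_bound xi)
       (lambda - eta2 * (V_init (utility M) pi - bbar)))
  else (theta0, lambda0).

Definition npgpd_policy (xi bbar eta1 eta2 : R) (theta0 : S -> A -> R)
    (lambda0 : R) (t : nat) : S -> A -> R :=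
  softmax (npgpd xi bbar eta1 eta2 theta0 lambda0 t).1.

End Values.

(* Main.v *)
Require Import Defs.
From HB Require Import structures.
From mathcomp Require Import all_boot all_order all_algebra.
From mathcomp Require Import all_classical all_reals all_analysis.
From mathcomp Require Import ring lra.

(* A one-sided comparison principle for the Bellman operator gives uniqueness
   of its fixed point. Hence V^pi is linear and monotone in the reward, and the
   performance difference V^pi' - V^pi is the value under pi' of the advantage
   A^pi. Summing the multiplicative-weights identity
     kappa A^(t) = log pi^(t+1) - log pi^(t) + log Z^(t)
   along a comparator pi, with log Z^(t) <= kappa (V^(t+1) - V^(t)) pointwise, and
   adding the regret of projected gradient descent in lambda, bounds
     avg_t (V_r^pi - V_r^(t)) + lambda (bbar - avg_t V_g^(t)) <= K / sqrt T
   for each lambda in Lambda and each pi with V_g^pi >= bbar. Occupancy measures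
   form a convex set, so the average of the values of the iterates is the value
   of one policy pbar. Mixing pbar with a Slater policy and taking lambda maximal
   shows that pbar violates the constraint for bbar by at most eps / 2 = delta,
   hence is feasible for b. Mixing an arbitrary feasible policy with the Slater
   policy and taking lambda = 0 bounds the optimality gap. *)

Set Implicit Arguments.
Unset Strict Implicit.
Unset Printing Implicit Defensive.

Import Order.TTheory GRing.Theory Num.Theory.
Import numFieldNormedType.Exports.

Local Open Scope ring_scope.

(** * Bellman equations from trajectories *)
Section Trajectories.
Variables (R : realType) (S A : finType) (M : cmdp R S A).
Implicit Types (pi f : S -> A -> R) (mu : S * A -> R) (x y : S * A).

(** The transition kernel of the state-action chain; with pairs as states, V and Q differ only in
    the starting law. *)
Definition step pi x y : R := trans M x.1 x.2 y.1 * pi y.1 y.2.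

Lemma sum_tuple_cons (X : finType) n (F : n.+1.-tuple X -> R) :
  \sum_w F w = \sum_x \sum_(w : n.-tuple X) F [tuple of x :: w].
Proof.
rewrite pair_bigA /= (reindex (fun p : X * n.-tuple X => [tuple of p.1 :: p.2])) //=.
exists (fun w : n.+1.-tuple X => (thead w, [tuple of behead w])) => [[x w] _|w _] /=.
  by rewrite theadE; congr pair; apply: val_inj.
by rewrite [RHS]tuple_eta; apply: val_inj.
Qed.

Lemma sum_pair (X Y : finType) (F : X * Y -> R) :
  \sum_p F p = \sum_x \sum_y F (x, y).
Proof. by rewrite pair_bigA; apply: eq_bigr => -[]. Qed.

(** The Markov property: past the first pair, the tail is a trajectory with starting law
    [step pi x]. Inductions on the horizon therefore keep [mu] arbitrary. *)
Lemma traj_prob_cons pi mu n x (w : n.+1.-tuple (S * A)) :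
  traj_prob M pi mu [tuple of x :: w] = mu x * traj_prob M pi (step pi x) w.
Proof.
rewrite /traj_prob (tnth_nth x) /= big_ord_recl; congr (_ * _).
rewrite !(tnth_nth x) /= !inordK //= /step; congr (_ * _).
apply: eq_bigr => i _ /=; rewrite !(tnth_nth x) /= !inordK //=.
- by rewrite ltnS ltn_ord.
- by rewrite ltnS ltnW.
- by rewrite /bump /= add1n !ltnS ltn_ord.
- by rewrite /bump /= add1n !ltnS ltnW.
Qed.

Lemma return_upto_cons f n x (w : n.+1.-tuple (S * A)) :
  return_upto M f [tuple of x :: w] = f x.1 x.2 + discount M * return_upto M f w.
Proof.
rewrite /return_upto big_ord_recl (tnth_nth x) /= expr0 mul1r; congr (_ + _).
rewrite mulr_sumr; apply: eq_bigr => i _.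
by rewrite !(tnth_nth x) /= /bump /= add1n exprS mulrA.
Qed.

Lemma sum_step pi x : is_policy pi -> \sum_y step pi x y = 1.
Proof.
move=> ppi; rewrite sum_pair.
rewrite -(proj2 (trans_dist M x.1 x.2)); apply: eq_bigr => s _.
by under eq_bigr do rewrite /step /=; rewrite -mulr_sumr (proj2 (ppi s)) mulr1.
Qed.

Lemma step_ge0 pi x y : is_policy pi -> 0 <= step pi x y.
Proof.
by move=> ppi; apply: mulr_ge0; [apply: (proj1 (trans_dist M _ _)) | apply: (proj1 (ppi _))].
Qed.

Lemma sum_traj_prob pi mu n : is_policy pi ->
  \sum_(w : n.+1.-tuple (S * A)) traj_prob M pi mu w = \sum_x mu x.
Proof.
move=> ppi; elim: n mu => [|n IH] mu; rewrite sum_tuple_cons.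
  apply: eq_bigr => x _; rewrite (eq_bigr (fun=> mu x)) => [|w _].
    by rewrite sumr_const card_tuple expn0.
  by rewrite /traj_prob big_ord0 mulr1 (tnth_nth x).
apply: eq_bigr => x _.
under eq_bigr do rewrite traj_prob_cons.
by rewrite -mulr_sumr IH sum_step ?mulr1.
Qed.

(** The expected reward at time [k] from [x], already carrying the factor gamma^k, so that
    infinite-horizon values are plain series of these terms. *)
Fixpoint stage_reward pi f (k : nat) x : R :=
  if k is k'.+1 then discount M * \sum_y step pi x y * stage_reward pi f k' y
  else f x.1 x.2.

Lemma expected_return_upto pi f mu n : is_policy pi ->
  \sum_(w : n.+1.-tuple (S * A)) traj_prob M pi mu w * return_upto M f w =
  \sum_x mu x * \sum_(k < n.+1) stage_reward pi f k x.
Proof.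
move=> ppi; elim: n mu => [|n IH] mu; rewrite sum_tuple_cons; apply: eq_bigr => x _.
  rewrite big_ord1 /= (eq_bigr (fun=> mu x * f x.1 x.2)) => [|w _].
    by rewrite sumr_const card_tuple expn0.
  by rewrite /traj_prob /return_upto big_ord0 big_ord1 mulr1 expr0 mul1r (tnth_nth x).
under eq_bigr do rewrite traj_prob_cons return_upto_cons -mulrA mulrDr mulrCA.
rewrite -mulr_sumr big_split /= -mulr_suml sum_traj_prob // sum_step // mul1r.
rewrite -mulr_sumr IH; congr (_ * _); rewrite [RHS]big_ord_recl /=; congr (_ + _).
rewrite -mulr_sumr; congr (_ * _); rewrite exchange_big; apply: eq_bigr => y _.
by rewrite mulr_sumr.
Qed.

(** Each recursion step averages and multiplies by gamma, so the sup norm contracts; the sum of all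
    [|f|] crudely bounds that norm. An arbitrary [f] is allowed because advantages and log-policies
    later serve as rewards. *)
Lemma stage_reward_le pi f k x : is_policy pi ->
  `|stage_reward pi f k x| <= (\sum_y `|f y.1 y.2|) * discount M ^+ k.
Proof.
move=> ppi; have /andP[g0 _] := discount_bound M.
elim: k x => [|k IH] x /=.
  by rewrite expr0 mulr1 (bigD1 x) //= lerDl sumr_ge0.
rewrite normrM (ger0_norm g0) exprS mulrCA ler_wpM2l //.
apply: le_trans (ler_norm_sum _ _ _) _.
rewrite -[leRHS]mul1r -(sum_step x ppi) mulr_suml; apply: ler_sum => y _.
by rewrite normrM (ger0_norm (step_ge0 _ _ ppi)) ler_wpM2l // step_ge0.
Qed.

Lemma cvg_stage_reward pi f x : is_policy pi ->
  cvgn (series (fun k => stage_reward pi f k x)).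
Proof.
move=> ppi; have /andP[g0 g1] := discount_bound M.
apply: normed_cvg; apply: (@series_le_cvg _ _ (geometric (\sum_y `|f y.1 y.2|) (discount M))).
- by move=> n; rewrite normr_ge0.
- by move=> n; rewrite /geometric /= mulr_ge0 ?exprn_ge0 ?sumr_ge0.
- by move=> n; rewrite /geometric /= stage_reward_le.
- by apply: is_cvg_geometric_series; rewrite ger0_norm.
Qed.

Lemma cvg_weighted_sum (I : finType) (c : I -> R) (u : I -> nat -> R) (l : I -> R) :
  (forall i, (u i @ \oo --> l i)%classic) ->
  ((fun n => \sum_i c i * u i n) @ \oo --> \sum_i c i * l i)%classic.
Proof.
move=> cu; apply: cvg_big => [|i _]; first exact: add_continuous.
by apply: cvgM; [exact: cvg_cst | exact: cu].
Qed.

Lemma expected_returnE pi f mu : is_policy pi ->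
  expected_return M pi f mu =
  \sum_x mu x * limn (series (fun k => stage_reward pi f k x)).
Proof.
move=> ppi; rewrite /expected_return.
under eq_fun do rewrite expected_return_upto //.
apply/cvg_lim => //; apply: cvg_weighted_sum => x.
under eq_fun do rewrite -(big_mkord xpredT (fun k => stage_reward pi f k x)).
have := @cvg_stage_reward pi f x ppi.
by rewrite -(cvg_shiftS (series _)).
Qed.

Lemma Q_valueE pi f s a : is_policy pi ->
  Q_value M f pi s a = limn (series (fun k => stage_reward pi f k (s, a))).
Proof.
move=> ppi; rewrite /Q_value expected_returnE // (bigD1 (s, a)) //= eqxx mul1r.
by rewrite big1 ?addr0 // => x /negbTE ->; rewrite mul0r.
Qed.

Lemma V_valueE pi f s : is_policy pi ->
  V_value M f pi s = \sum_a pi s a * Q_value M f pi s a.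
Proof.
move=> ppi; rewrite /V_value expected_returnE //.
rewrite sum_pair.
rewrite (bigD1 s) //= [X in _ + X]big1 ?addr0 => [|s' /negbTE s's].
  by apply: eq_bigr => a _; rewrite /= eqxx mul1r Q_valueE.
by rewrite big1 // => a _; rewrite /= s's !mul0r.
Qed.

Lemma bellman_Q pi f s a : is_policy pi ->
  Q_value M f pi s a =
  f s a + discount M * \sum_s' trans M s a s' * V_value M f pi s'.
Proof.
move=> ppi; rewrite Q_valueE //; apply/cvg_lim => //.
(* Shifting the partial sums by one splits off the immediate reward and leaves discounted partial
   sums started from the next pair. *)
rewrite -(cvg_shiftS (series _)).
under eq_fun => n.
  rewrite /series /= big_mkord big_ord_recl /= -mulr_sumr exchange_big /=.
  under eq_bigr do rewrite -mulr_sumr -(big_mkord xpredT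
    (fun k => stage_reward pi f k _)).
  over.
apply: cvgD; first exact: cvg_cst.
apply: cvgM; first exact: cvg_cst.
have -> : \sum_s' trans M s a s' * V_value M f pi s' =
   \sum_y step pi (s, a) y * limn (series (fun k => stage_reward pi f k y)).
  rewrite sum_pair; apply: eq_bigr => s' _; rewrite V_valueE // mulr_sumr; apply: eq_bigr => a' _.
  by rewrite mulrA Q_valueE.
by apply: cvg_weighted_sum => y; exact: cvg_stage_reward.
Qed.

End Trajectories.

(** * Comparison principle and occupancy measures *)
Section ValueFunctions.
Variables (R : realType) (S A : finType) (M : cmdp R S A).
Implicit Types (pi f h : S -> A -> R) (W : S -> R).
Local Notation gamma := (discount M).

Lemma discount_gap : 0 < 1 - gamma.
Proof. by have /andP[_] := discount_bound M; rewrite subr_gt0. Qed.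

Lemma dist_average_const (X : finType) (p : X -> R) (c : R) :
  is_dist p -> \sum_x p x * c = c.
Proof. by case=> _ p1; rewrite -mulr_suml p1 mul1r. Qed.

Lemma dist_average_le (X : finType) (p u v : X -> R) :
  is_dist p -> (forall x, u x <= v x) -> \sum_x p x * u x <= \sum_x p x * v x.
Proof. by case=> p0 _ uv; apply: ler_sum => x _; rewrite ler_wpM2l. Qed.

Definition expected_next W s a : R := \sum_s' trans M s a s' * W s'.

Lemma bellman_V pi f s : is_policy pi ->
  V_value M f pi s =
  \sum_a pi s a * (f s a + gamma * expected_next (V_value M f pi) s a).
Proof.
by move=> ppi; rewrite V_valueE //; apply: eq_bigr => a _; rewrite bellman_Q.
Qed.

(* The hypothesis at a minimiser m of W reads gamma * W m <= W m. *)
Lemma supersolution_ge0 pi W : is_policy pi ->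
  (forall s, \sum_a pi s a * (gamma * expected_next W s a) <= W s) ->
  forall s, 0 <= W s.
Proof.
move=> ppi hW s.
case: (@arg_minP _ R S s xpredT W isT) => m _ minm.
suff Wm : 0 <= W m by apply: le_trans Wm (minm s isT).
have /andP[g0 _] := discount_bound M.
suff : gamma * W m <= W m by have := discount_gap; nra.
apply: le_trans (hW m); rewrite -(dist_average_const (gamma * W m) (ppi m)).
apply: dist_average_le => // a; rewrite ler_wpM2l //.
rewrite -(dist_average_const (W m) (trans_dist M m a)).
by apply: dist_average_le => [|s']; [exact: trans_dist | exact: minm].
Qed.

(** The reward cancels in [W] - V^pi, which is thus a supersolution for zero reward. *)
Lemma V_value_supersolution pi f W : is_policy pi ->
  (forall s, \sum_a pi s a * (f s a + gamma * expected_next W s a) <= W s) ->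
  forall s, V_value M f pi s <= W s.
Proof.
move=> ppi hW s; rewrite -subr_ge0; move: s.
apply: (supersolution_ge0 ppi) => s.
apply: le_trans (lerB (hW s) (lexx (V_value M f pi s))).
rewrite [X in _ - X]bellman_V // -sumrB; apply: ler_sum => a _.
rewrite -mulrBr opprD addrACA subrr add0r -mulrBr /expected_next -sumrB.
by under [in leRHS]eq_bigr do rewrite -mulrBr.
Qed.

Lemma V_value_subsolution pi f W : is_policy pi ->
  (forall s, W s <= \sum_a pi s a * (f s a + gamma * expected_next W s a)) ->
  forall s, W s <= V_value M f pi s.
Proof.
move=> ppi hW s; rewrite -subr_ge0; move: s.
apply: (supersolution_ge0 ppi) => s.
apply: le_trans (lerB (lexx (V_value M f pi s)) (hW s)).
rewrite [X in X - _]bellman_V // -sumrB; apply: ler_sum => a _.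
rewrite -mulrBr opprD addrACA subrr add0r -mulrBr /expected_next -sumrB.
by under [in leRHS]eq_bigr do rewrite -mulrBr.
Qed.

Lemma V_value_unique pi f W : is_policy pi ->
  (forall s, W s = \sum_a pi s a * (f s a + gamma * expected_next W s a)) ->
  forall s, V_value M f pi s = W s.
Proof.
move=> ppi hW s; apply/eqP; rewrite eq_le.
by rewrite V_value_supersolution ?V_value_subsolution // => s'; rewrite -hW.
Qed.

Lemma V_value_sum (I : finType) (c : I -> R) (F : I -> S -> A -> R) pi s :
  is_policy pi ->
  V_value M (fun s a => \sum_i c i * F i s a) pi s =
  \sum_i c i * V_value M (F i) pi s.
Proof.
move=> ppi.
apply: (V_value_unique (W := fun s => \sum_i c i * V_value M (F i) pi s) ppi) => {}s.
under eq_bigr do rewrite bellman_V // mulr_sumr.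
rewrite exchange_big; apply: eq_bigr => a _ /=.
under eq_bigr do rewrite mulrCA mulrDr.
rewrite -mulr_sumr big_split /=; congr (_ * (_ + _)).
under eq_bigr do rewrite mulrCA.
rewrite -mulr_sumr; congr (_ * _).
under eq_bigr do rewrite /expected_next mulr_sumr.
rewrite exchange_big; apply: eq_bigr => s' _ /=.
by rewrite mulr_sumr; apply: eq_bigr => i _; rewrite mulrCA.
Qed.

Lemma V_value_lin (c d : R) f h pi s : is_policy pi ->
  V_value M (fun s a => c * f s a + d * h s a) pi s =
  c * V_value M f pi s + d * V_value M h pi s.
Proof.
move=> ppi.
have := V_value_sum (fun b : bool => if b then c else d)
  (fun b => if b then f else h) s ppi.
rewrite big_bool /= => <-; congr (V_value _ _ _ _).
by apply/funext => s'; apply/funext => a'; rewrite big_bool.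
Qed.

(** This reward telescopes along trajectories. Averaged over [init M], the identity is the flow
    equation of occupancy measures. *)
Lemma V_value_potential pi W s : is_policy pi ->
  V_value M (fun s a => W s - gamma * expected_next W s a) pi s = W s.
Proof.
move=> ppi; apply: (V_value_unique ppi) => {}s.
under eq_bigr do rewrite subrK.
by rewrite dist_average_const.
Qed.

Lemma V_value_const pi (c : R) s : is_policy pi ->
  V_value M (fun _ _ => c) pi s = c / (1 - gamma).
Proof.
move=> ppi; have g1 := discount_gap.
apply: (V_value_unique (W := fun=> c / (1 - gamma)) ppi) => s'.
rewrite -[LHS](dist_average_const _ (ppi s')).
apply: eq_bigr => a _; congr (_ * _).
rewrite /expected_next (dist_average_const _ (trans_dist M s' a)).
by field; rewrite lt0r_neq0.
Qed.

Lemma V_value_le pi f h s : is_policy pi -> (forall s a, f s a <= h s a) ->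
  V_value M f pi s <= V_value M h pi s.
Proof.
move=> ppi fh; apply: (V_value_supersolution ppi) => {}s.
rewrite [leRHS]bellman_V //; apply: dist_average_le => // a.
by rewrite lerD2r.
Qed.

(** V^pi' - V^pi solves the Bellman equation of [pi'] with reward A^pi, so uniqueness applies. *)
Lemma performance_difference pi pi' f s : is_policy pi -> is_policy pi' ->
  V_value M (advantage M f pi) pi' s = V_value M f pi' s - V_value M f pi s.
Proof.
move=> ppi ppi'.
apply: (V_value_unique (W := fun s => V_value M f pi' s - V_value M f pi s) ppi').
move=> {}s; rewrite {1}[V_value M f pi' s]bellman_V //.
rewrite -{1}(dist_average_const (V_value M f pi s) (ppi' s)) -sumrB.
apply: eq_bigr => a _; rewrite -mulrBr; congr (_ * _).
rewrite /advantage bellman_Q // -/(expected_next _ _ _).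
have -> : expected_next (fun s0 => V_value M f pi' s0 - V_value M f pi s0) s a =
  expected_next (V_value M f pi') s a - expected_next (V_value M f pi) s a.
  by rewrite /expected_next -sumrB; apply: eq_bigr => s' _; rewrite mulrBr.
by ring.
Qed.

(** Nonnegative statewise averages of [h] make every continuation value nonnegative. Applied to an
    advantage, this bounds its one-step average by the value gain. *)
Lemma V_value_ge_immediate pi h s : is_policy pi ->
  (forall s, 0 <= \sum_a pi s a * h s a) ->
  \sum_a pi s a * h s a <= V_value M h pi s.
Proof.
move=> ppi h0; have /andP[g0 _] := discount_bound M.
have V0 s' : 0 <= V_value M h pi s'.
  apply: (V_value_subsolution (W := fun=> 0) ppi) => {}s'.
  apply: le_trans (h0 s') _; apply: dist_average_le => // a.
  by rewrite /expected_next big1 ?mulr0 ?addr0 // => i _; rewrite mulr0.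
rewrite bellman_V //; apply: dist_average_le => // a; rewrite lerDl mulr_ge0 //.
by apply: sumr_ge0 => s' _; rewrite mulr_ge0 //; exact: (proj1 (trans_dist M _ _)).
Qed.

Lemma V_init_sum (I : finType) (c : I -> R) (F : I -> S -> A -> R) pi :
  is_policy pi ->
  V_init M (fun s a => \sum_i c i * F i s a) pi = \sum_i c i * V_init M (F i) pi.
Proof.
move=> ppi; rewrite /V_init.
under eq_bigr do rewrite V_value_sum // mulr_sumr.
rewrite exchange_big; apply: eq_bigr => i _ /=.
by rewrite mulr_sumr; apply: eq_bigr => s _; rewrite mulrCA.
Qed.

Lemma V_init_lin (c d : R) f h pi : is_policy pi ->
  V_init M (fun s a => c * f s a + d * h s a) pi =
  c * V_init M f pi + d * V_init M h pi.
Proof.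
move=> ppi; rewrite /V_init !mulr_sumr -big_split; apply: eq_bigr => s _ /=.
by rewrite V_value_lin // mulrDr !(mulrCA _ (init M s)).
Qed.

Lemma V_init_le pi f h : is_policy pi -> (forall s a, f s a <= h s a) ->
  V_init M f pi <= V_init M h pi.
Proof.
by move=> ppi fh; apply: (dist_average_le (init_dist M)) => s; exact: V_value_le.
Qed.

Lemma V_init_const pi (c : R) : is_policy pi ->
  V_init M (fun _ _ => c) pi = c / (1 - gamma).
Proof.
move=> ppi; rewrite /V_init.
by under eq_bigr do rewrite V_value_const //; rewrite (dist_average_const _ (init_dist M)).
Qed.

Lemma V_value_bound pi f s : is_policy pi -> (forall s a, 0 <= f s a <= 1) ->
  0 <= V_value M f pi s <= (1 - gamma)^-1.
Proof.
move=> ppi f01; rewrite -{1}(mul0r (1 - gamma)^-1) -[X in _ <= _ <= X]mul1r.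
by rewrite -!(V_value_const _ s ppi) !V_value_le // => s' a; have /andP[] := f01 s' a.
Qed.

Lemma V_init_bound pi f : is_policy pi -> (forall s a, 0 <= f s a <= 1) ->
  0 <= V_init M f pi <= (1 - gamma)^-1.
Proof.
move=> ppi f01; rewrite -{1}(mul0r (1 - gamma)^-1) -[X in _ <= _ <= X]mul1r.
by rewrite -!(V_init_const _ ppi) !V_init_le // => s' a; have /andP[] := f01 s' a.
Qed.

Lemma V_init_advantage pi pi' f : is_policy pi -> is_policy pi' ->
  V_init M (advantage M f pi) pi' = V_init M f pi' - V_init M f pi.
Proof.
move=> ppi ppi'; rewrite /V_init -sumrB; apply: eq_bigr => s _.
by rewrite performance_difference // mulrBr.
Qed.

(** The unnormalised discounted occupancy measure, of total mass 1/(1 - gamma); as the value of an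
    indicator reward it inherits linearity and monotonicity from [V_init]. *)
Definition occupancy pi s a : R :=
  V_init M (fun s' a' => ((s', a') == (s, a))%:R) pi.

Lemma occupancy_ge0 pi s a : is_policy pi -> 0 <= occupancy pi s a.
Proof.
move=> ppi; rewrite -(mul0r (1 - gamma)^-1) -(V_init_const _ ppi).
by apply: V_init_le => // s' a'; exact: ler0n.
Qed.

Lemma V_init_occupancy pi f : is_policy pi ->
  V_init M f pi = \sum_s \sum_a occupancy pi s a * f s a.
Proof.
move=> ppi; rewrite -(sum_pair (fun x => occupancy pi x.1 x.2 * f x.1 x.2)).
have := V_init_sum (fun x : S * A => f x.1 x.2)
  (fun x s a => ((s, a) == (x.1, x.2))%:R) ppi.
under [RHS]eq_bigr do rewrite mulrC.
move=> <-; congr (V_init _ _ _); apply/funext => s; apply/funext => a.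
rewrite (bigD1 (s, a)) //= eqxx mulr1 big1 ?addr0 // => -[s' a'] /=.
by rewrite eq_sym => /negbTE ->; rewrite mulr0.
Qed.

(* Occupancy measures are the nonnegative solutions of the flow equation
   [flow], a convex set; the policy a |-> m s a / \sum_b m s b has occupancy m. *)
Lemma policy_of_occupancy (m : S -> A -> R) pi0 : is_policy pi0 ->
  (forall s a, 0 <= m s a) ->
  (forall W, \sum_s \sum_a m s a * (W s - gamma * expected_next W s a) =
             \sum_s init M s * W s) ->
  exists pi, is_policy pi /\ forall f, V_init M f pi = \sum_s \sum_a m s a * f s a.
Proof.
move=> ppi0 m0 flow; pose n s := \sum_a m s a.
have n0 s : 0 <= n s by apply: sumr_ge0 => a _; exact: m0.
(* States without mass get the default [pi0]; there [m] vanishes, so m = n pi holds for any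
   choice. *)
pose pi s a := if n s == 0 then pi0 s a else m s a / n s.
have ppi : is_policy pi.
  move=> s; rewrite /pi; case: eqP => [_|/eqP ns]; first exact: ppi0.
  by split=> [a|]; [rewrite divr_ge0 | rewrite -mulr_suml mulfV].
have mE s a : m s a = n s * pi s a.
  rewrite /pi; case: eqP => [ns|/eqP ns]; last by rewrite mulrCA mulfV ?mulr1.
  rewrite ns mul0r; apply/eqP; rewrite eq_le m0 andbT -ns /n (bigD1 a) //=.
  by rewrite lerDl sumr_ge0.
exists pi; split=> // f.
(* The Bellman residual of [pi] averages to zero at every state. Combined with [flow] at W = V^pi,
   it turns the sum of m (V - gamma P V) into the sum of m f. *)
have residual0 : \sum_s n s * \sum_a pi s a *
    (f s a + gamma * expected_next (V_value M f pi) s a - V_value M f pi s) = 0.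
  apply: big1 => s _; under eq_bigr do rewrite mulrBr.
  by rewrite sumrB -bellman_V // dist_average_const // subrr mulr0.
rewrite /V_init -flow -[RHS]subr0 -[X in _ = _ - X]residual0.
rewrite -sumrB; apply: eq_bigr => s _; rewrite mulr_sumr -sumrB.
by apply: eq_bigr => a _; rewrite mE; ring.
Qed.

(** Averaging action probabilities state by state would not average values. Averaging occupancy
    measures does, and the average still satisfies the flow equation by linearity. *)
Lemma policy_mixture (I : finType) (c : I -> R) (pis : I -> S -> A -> R) :
  is_dist c -> (forall i, is_policy (pis i)) ->
  exists pi, is_policy pi /\
    forall f, V_init M f pi = \sum_i c i * V_init M f (pis i).
Proof.
move=> [c0 c1] ppis.
have [i0 _] : exists i : I, true.
  apply/existsP; apply: contraT; rewrite negb_exists => /forallP noI.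
  move/eqP: c1; rewrite big1 ?(eq_sym 0) ?oner_eq0 // => i _.
  by have := noI i.
have mixE (f : S -> A -> R) :
    \sum_s \sum_a (\sum_i c i * occupancy (pis i) s a) * f s a =
    \sum_i c i * V_init M f (pis i).
  under [RHS]eq_bigr do rewrite V_init_occupancy // mulr_sumr.
  rewrite [RHS]exchange_big; apply: eq_bigr => s _ /=.
  under [RHS]eq_bigr do rewrite mulr_sumr.
  rewrite [RHS]exchange_big; apply: eq_bigr => a _ /=.
  by rewrite mulr_suml; apply: eq_bigr => i _; rewrite mulrA.
have [|W|pi [ppi piE]] :=
  @policy_of_occupancy (fun s a => \sum_i c i * occupancy (pis i) s a) _ (ppis i0).
- by move=> s a; apply: sumr_ge0 => i _; rewrite mulr_ge0 ?occupancy_ge0.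
- rewrite (mixE (fun s a => W s - gamma * expected_next W s a)) -[RHS]mul1r -c1 mulr_suml.
  apply: eq_bigr => i _; congr (_ * _).
  by apply: eq_bigr => s _; rewrite V_value_potential.
by exists pi; split=> // f; rewrite piE.
Qed.

End ValueFunctions.

(** * Natural policy gradient steps *)
Section NaturalPolicyGradient.
Variables (R : realType) (S A : finType) (M : cmdp R S A).
Hypothesis A_gt0 : (0 < #|A|)%N.
Implicit Types (pi f theta : S -> A -> R).
Local Notation gamma := (discount M).

Definition lse theta s : R := ln (\sum_a expR (theta s a)).

Definition log_softmax theta s a : R := theta s a - lse theta s.

Lemma softmaxE theta s a : softmax theta s a = expR (log_softmax theta s a).
Proof.
have [a0 _] : exists a : A, true.
  by move/card_gt0P: A_gt0 => [a0 _]; exists a0.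
rewrite /log_softmax /lse expRD expRN lnK // posrE (bigD1 a0) //=.
by rewrite ltr_pwDl ?expR_gt0 // sumr_ge0 // => i _; rewrite expR_ge0.
Qed.

Lemma softmax_policy theta : is_policy (softmax theta).
Proof.
move=> s; split=> [a|]; first by rewrite softmaxE expR_ge0.
rewrite -mulr_suml mulfV //; have [a0 _] := card_gt0P A_gt0.
rewrite gt_eqF // (bigD1 a0) //=.
by rewrite ltr_pwDl ?expR_gt0 // sumr_ge0 // => i _; rewrite expR_ge0.
Qed.

Lemma log_softmax_le0 theta s a : log_softmax theta s a <= 0.
Proof.
rewrite -expR_le1 -softmaxE -(proj2 (softmax_policy theta s)) (bigD1 a) //=.
by rewrite lerDl sumr_ge0 // => i _; exact: (proj1 (softmax_policy theta s)).
Qed.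

(* Gibbs' inequality; equivalently, convexity of lse, whose gradient is softmax. *)
Lemma lse_convex theta theta' s :
  \sum_a softmax theta s a * (theta' s a - theta s a) <= lse theta' s - lse theta s.
Proof.
have ptheta := softmax_policy theta s.
rewrite -subr_le0 -(dist_average_const (lse theta' s - lse theta s) ptheta) -sumrB.
have sum0 : \sum_a softmax theta' s a - \sum_a softmax theta s a = 0.
  by rewrite !(proj2 (softmax_policy _ _)) subrr.
rewrite -[leRHS]sum0 -[leRHS]sumrB; apply: ler_sum => a _.
have -> : softmax theta' s a = softmax theta s a *
    expR (theta' s a - theta s a - (lse theta' s - lse theta s)).
  by rewrite !softmaxE -expRD /log_softmax; congr expR; ring.
rewrite -mulrBr -[X in _ <= _ - X]mulr1 -mulrBr ler_wpM2l ?(proj1 ptheta) //.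
by rewrite lerBrDl expR_ge1Dx.
Qed.

(** Covers the degenerate case where the step size 2 log|A| is zero and the regret argument cannot
    divide by it. *)
Lemma policy_unique pi pi' : #|A| = 1%N -> is_policy pi -> is_policy pi' -> pi = pi'.
Proof.
move=> /eqP/card1P[a0 Aa0] ppi ppi'; apply/funext => s; apply/funext => a.
have all_a0 b : b = a0 by apply/eqP; have := Aa0 b; rewrite !inE => <-.
have one (q : A -> R) : is_dist q -> q a = 1.
  move=> [_ <-]; rewrite (bigD1 a) //= big1 ?addr0 // => b.
  by rewrite (all_a0 b) (all_a0 a) eqxx.
by rewrite (one _ (ppi s)) (one _ (ppi' s)).
Qed.

Lemma average_advantage pi f s : is_policy pi ->
  \sum_a pi s a * advantage M f pi s a = 0.
Proof.
move=> ppi; under eq_bigr do rewrite mulrBr.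
by rewrite sumrB -V_valueE // dist_average_const // subrr.
Qed.

(** Makes the update direction A_r + lambda A_g the advantage of the single reward r + lambda g, so
    the primal update is a plain natural gradient step. *)
Lemma advantage_lin (c d : R) f h pi s a : is_policy pi ->
  advantage M (fun s a => c * f s a + d * h s a) pi s a =
  c * advantage M f pi s a + d * advantage M h pi s a.
Proof.
move=> ppi; rewrite /advantage V_value_lin // !bellman_Q //.
have -> : \sum_s' trans M s a s' * V_value M (fun s a => c * f s a + d * h s a) pi s' =
    c * (\sum_s' trans M s a s' * V_value M f pi s') +
    d * \sum_s' trans M s a s' * V_value M h pi s'.
  rewrite !mulr_sumr -big_split; apply: eq_bigr => s' _.
  by rewrite V_value_lin //=; ring.
by ring.
Qed.

Section Step.
Variables (f : S -> A -> R) (kappa : R) (theta : S -> A -> R).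
Let theta' s a := theta s a + kappa * advantage M f (softmax theta) s a.

(* lse theta' - lse theta is the log-partition function of the multiplicative
   weights update; convexity of lse applied in both directions gives
   0 <= kappa^-1 * (lse theta' - lse theta) <= E_{pi'}[A]. *)
Lemma npg_lse_le_value s : 0 < kappa ->
  kappa^-1 * (lse theta' s - lse theta s) <=
  V_value M f (softmax theta') s - V_value M f (softmax theta) s.
Proof.
move=> k0; have [pp pp'] := (softmax_policy theta, softmax_policy theta').
have k_inv := mulVf (lt0r_neq0 k0).
have lse_ge0 s' : 0 <= kappa^-1 * (lse theta' s' - lse theta s').
  rewrite mulr_ge0 ?invr_ge0 ?(ltW k0) //; apply: le_trans (lse_convex _ _ _).
  have -> // : \sum_a softmax theta s' a * (theta' s' a - theta s' a) = 0.
  rewrite -[RHS](mulr0 kappa) -[X in _ = _ * X](average_advantage f s' pp) mulr_sumr.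
  by apply: eq_bigr => a _; rewrite /theta'; ring.
have gain s' : kappa^-1 * (lse theta' s' - lse theta s') <=
    \sum_a softmax theta' s' a * advantage M f (softmax theta) s' a.
  have := lse_convex theta' theta s'.
  rewrite -(ler_pM2l (x := kappa^-1)) ?invr_gt0 // mulr_sumr => le_lse.
  rewrite -lerN2 -mulrN opprB; apply: le_trans le_lse.
  rewrite -sumrN le_eqVlt; apply/orP; left; apply/eqP; apply: eq_bigr => a _.
  by rewrite /theta' opprD addrA subrr add0r mulrN mulrN mulrCA (mulrA kappa^-1) k_inv mul1r.
rewrite -performance_difference //; apply: le_trans (gain s) _.
by apply: V_value_ge_immediate => // s'; apply: le_trans (lse_ge0 s') (gain s').
Qed.

(** Solving the update for the advantage expresses it as [kappa^-1] times the increments of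
    [log_softmax] and [lse]; the [lse] part is at most the value gain, pointwise. Averaging over the
    occupancy of [pi] gives the bound. *)
Lemma npg_step pi : is_policy pi -> 0 < kappa \/ kappa = 0 /\ #|A| = 1%N ->
  V_init M f pi - V_init M f (softmax theta) <=
  kappa^-1 * (V_init M (log_softmax theta') pi - V_init M (log_softmax theta) pi) +
  (V_init M (fun s _ => V_value M f (softmax theta') s) pi -
   V_init M (fun s _ => V_value M f (softmax theta) s) pi).
Proof.
move=> ppi; have pp := softmax_policy theta; case=> [k0|[k0 A1]]; last first.
  rewrite (policy_unique A1 ppi pp) subrr; have -> : theta' = theta.
    by apply/funext => s; apply/funext => a; rewrite /theta' k0 mul0r addr0.
  by rewrite !subrr mulr0 addr0.
have -> : V_init M f pi - V_init M f (softmax theta) =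
    V_init M (advantage M f (softmax theta)) pi by rewrite V_init_advantage.
have sub_lin (c : R) h h' : c * (V_init M h pi - V_init M h' pi) =
    V_init M (fun s a => c * h s a + - c * h' s a) pi.
  by rewrite V_init_lin // mulrBr mulNr.
rewrite -[X in _ <= _ + X]mul1r !sub_lin -[X in _ <= X + _]mul1r -[X in _ <= _ + X]mul1r.
rewrite -V_init_lin //; apply: V_init_le => // s a.
have := npg_lse_le_value s k0; rewrite !mul1r mulN1r => le_value.
apply: le_trans (lerD (lexx _) le_value); rewrite le_eqVlt; apply/orP; left; apply/eqP.
rewrite /log_softmax /theta'; field.
by rewrite lt0r_neq0.
Qed.

End Step.
End NaturalPolicyGradient.

(** * Interval projection, summation by parts and projected gradient descent *)

Section Sequences.
Variable R : realType.

Lemma proj_itv0_itv (u x : R) : 0 <= u -> 0 <= proj_itv0 u x <= u.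
Proof. by move=> u0; have [] := proj_itv0P x u0. Qed.

Lemma proj_itv0_contract (u x y : R) : 0 <= y <= u ->
  `|proj_itv0 u x - y| <= `|x - y|.
Proof.
move=> /andP[y0 yu]; rewrite /proj_itv0.
case: (leP x 0) => x0.
  by rewrite (min_idPl (le_trans y0 yu)) sub0r normrN ger0_norm // ler0_norm; lra.
by case: (leP x u) => // xu; rewrite !ger0_norm; lra.
Qed.

Lemma sqr_diff_le (x y u : R) : 0 <= x <= u -> 0 <= y <= u ->
  (x - y) ^+ 2 <= u ^+ 2.
Proof.
move=> /andP[x0 xu] /andP[y0 yu].
by rewrite -subr_ge0 subr_sqr mulr_ge0 //; lra.
Qed.

(** Summation by parts: increments weighted by a varying multiplier do not telescope, but moving the
    differences onto [l] costs at most [D * B] per step. *)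
Lemma abel_sum_le (l b : nat -> R) (B D : R) (T : nat) :
  (forall t, 0 <= l t) -> (forall t, 0 <= b t <= B) ->
  (forall t, `|l t.+1 - l t| <= D) ->
  \sum_(t < T) l t * (b t.+1 - b t) <= l T * b T + T%:R * (D * B).
Proof.
move=> l0 b0B lD; elim: T => [|T IH].
  by rewrite big_ord0 mul0r addr0 mulr_ge0 // (andP (b0B 0)).1.
rewrite big_ord_recr /= -natr1.
have /andP[b0 bB] := b0B T.+1; have := lD T; rewrite ler_norml => /andP[Dl Dr].
have le1 : (l T - l T.+1) * b T.+1 <= D * b T.+1 by apply: ler_wpM2r => //; lra.
have le2 : D * b T.+1 <= D * B by rewrite ler_wpM2l // (le_trans _ (lD T)).
by lra.
Qed.

(* Telescopes the decrease of (l t - lam)^2 under the nonexpansive projection. *)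
Lemma projected_gradient_regret (u eta K lam : R) (l x : nat -> R) (T : nat) :
  0 <= lam <= u -> 0 < eta ->
  (forall t, l t.+1 = proj_itv0 u (l t - eta * x t)) ->
  (forall t, `|x t| <= K) ->
  \sum_(t < T) (l t - lam) * x t <=
  ((l 0 - lam) ^+ 2 - (l T - lam) ^+ 2) / (2 * eta) + T%:R * (eta * K ^+ 2 / 2).
Proof.
move=> lamu eta0 lS xK; elim: T => [|T IH].
  by rewrite big_ord0 subrr !mul0r addr0.
rewrite big_ord_recr /= -natr1.
have x2 : x T ^+ 2 <= K ^+ 2.
  by rewrite -[x T ^+ 2]real_normK ?num_real // ler_sqr ?nnegrE // (le_trans _ (xK T)).
have : (l T.+1 - lam) ^+ 2 <= (l T - eta * x T - lam) ^+ 2.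
  rewrite -[leLHS]real_normK ?num_real // -[leRHS]real_normK ?num_real //.
  by rewrite ler_sqr ?nnegrE // lS proj_itv0_contract.
have -> : (l T - eta * x T - lam) ^+ 2 =
  (l T - lam) ^+ 2 - 2 * eta * ((l T - lam) * x T) + eta ^+ 2 * x T ^+ 2 by ring.
move=> leT.
have step : (l T - lam) * x T <=
    ((l T - lam) ^+ 2 - (l T.+1 - lam) ^+ 2) / (2 * eta) + eta * K ^+ 2 / 2.
  rewrite -(ler_pM2l (x := 2 * eta)) ?mulr_gt0 // [leRHS](_ : _ =
    (l T - lam) ^+ 2 - (l T.+1 - lam) ^+ 2 + eta ^+ 2 * K ^+ 2); last first.
    by field; rewrite lt0r_neq0.
  have : eta ^+ 2 * x T ^+ 2 <= eta ^+ 2 * K ^+ 2 by rewrite ler_wpM2l ?sqr_ge0.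
  by lra.
apply: le_trans (lerD IH step) _; rewrite le_eqVlt; apply/orP; left; apply/eqP.
by field; rewrite lt0r_neq0.
Qed.

End Sequences.

(** * Primal-dual regret *)
Section Regret.
Variables (R : realType) (S A : finType) (M : cmdp R S A).
Variables (xi bbar eta1 eta2 : R) (theta0 : S -> A -> R) (lambda0 : R).
Hypothesis A_gt0 : (0 < #|A|)%N.
Local Notation gamma := (discount M).
Local Notation G := ((1 - gamma)^-1).
Local Notation C := (dual_bound M xi).
Local Notation Vr := (V_init M (reward M)).
Local Notation Vg := (V_init M (utility M)).
Let theta_ t := (npgpd M xi bbar eta1 eta2 theta0 lambda0 t).1.
Let lambda_ t := (npgpd M xi bbar eta1 eta2 theta0 lambda0 t).2.
Let pi_ t := npgpd_policy M xi bbar eta1 eta2 theta0 lambda0 t.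
(** The factor 1 gives the shape [c * f + d * h] of the linearity lemmas. *)
Let lagrangian (l : R) s a := 1 * reward M s a + l * utility M s a.

Lemma npgpd_policyP t : is_policy (pi_ t).
Proof. exact: softmax_policy. Qed.

Lemma theta_rec t : theta_ t.+1 = fun s a => theta_ t s a +
  eta1 / (1 - gamma) * advantage M (lagrangian (lambda_ t)) (softmax (theta_ t)) s a.
Proof.
rewrite /theta_ /lambda_ /=; case: npgpd => theta l /=.
apply/funext => s; apply/funext => a; rewrite advantage_lin ?mul1r //.
exact: softmax_policy.
Qed.

Lemma lambda_rec t :
  lambda_ t.+1 = proj_itv0 C (lambda_ t - eta2 * (Vg (pi_ t) - bbar)).
Proof. by rewrite /lambda_ /pi_ /npgpd_policy /=; case: npgpd. Qed.

Hypothesis lambda0_itv : 0 <= lambda0 <= C.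

Lemma lambda_itv t : 0 <= lambda_ t <= C.
Proof.
case: t => [|t]; first exact: lambda0_itv.
by rewrite lambda_rec; apply: proj_itv0_itv; case/andP: lambda0_itv; exact: le_trans.
Qed.

Variables (pi : S -> A -> R) (K : R).
Hypothesis ppi : is_policy pi.
(** The iterate's value function, treated as a reward and averaged over the comparator's occupancy;
    occupancy mass and value each contribute a factor [G] to its bound. *)
Let U f t := V_init M (fun s _ => V_value M f (pi_ t) s) pi.

Lemma U_bound f t : (forall s a, 0 <= f s a <= 1) -> 0 <= U f t <= G ^+ 2.
Proof.
move=> f01; rewrite -{1}(mul0r G) expr2 -!(V_init_const M _ ppi).
by rewrite !V_init_le // => s a; have /andP[] := V_value_bound M s (npgpd_policyP t) f01.
Qed.

Hypothesis eta1P : 0 < eta1 \/ eta1 = 0 /\ #|A| = 1%N.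
(** Since [theta0] is arbitrary, this sum replaces the bound log|A| available for a uniform initial
    policy. *)
Let B : R := \sum_s \sum_a `|log_softmax theta0 s a|.
Let kappa := eta1 / (1 - gamma).

Lemma lagrangian_step t :
  Vr pi - Vr (pi_ t) + lambda_ t * (Vg pi - Vg (pi_ t)) <=
  kappa^-1 * (V_init M (log_softmax (theta_ t.+1)) pi -
              V_init M (log_softmax (theta_ t)) pi) +
  (U (reward M) t.+1 - U (reward M) t) +
  lambda_ t * (U (utility M) t.+1 - U (utility M) t).
Proof.
have UE t' : V_init M (fun s _ => V_value M (lagrangian (lambda_ t)) (pi_ t') s) pi =
    U (reward M) t' + lambda_ t * U (utility M) t'.
  rewrite -[X in X + _]mul1r -V_init_lin //; congr (V_init _ _ _).
  by apply/funext => s; apply/funext => a; rewrite V_value_lin //; exact: npgpd_policyP.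
have kP : 0 < kappa \/ kappa = 0 /\ #|A| = 1%N.
  case: eta1P => [e0|[e0 A1]]; last by right; rewrite /kappa e0 mul0r.
  by left; rewrite divr_gt0 // discount_gap.
have := npg_step M A_gt0 (lagrangian (lambda_ t)) (theta_ t) ppi kP.
rewrite -theta_rec -[softmax (theta_ t)]/(pi_ t) -[softmax (theta_ t.+1)]/(pi_ t.+1) !UE.
rewrite !V_init_lin //; last exact: npgpd_policyP.
move: (kappa^-1 * _) (U _ t) (U _ t.+1) (U (utility M) t) (U (utility M) t.+1).
move: (Vr pi) (Vr (pi_ t)) (Vg pi) (Vg (pi_ t)) (lambda_ t) => *; lra.
Qed.

Hypotheses (eta2_gt0 : 0 < eta2) (bbarK : 0 <= bbar <= K) (GK : G <= K).

Lemma violation_le t : `|Vg (pi_ t) - bbar| <= K.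
Proof.
have /andP[V0 VG] := V_init_bound M (npgpd_policyP t) (utility_bound M).
have /andP[b0 bK] := bbarK; rewrite ler_norml.
by have VK := le_trans VG GK; apply/andP; split; lra.
Qed.

(** The log-policy and reward terms telescope, with log pi^(T) <= 0 and log pi^(0) >= -B. The
    utility terms go through [abel_sum_le], since one dual step moves lambda by at most
    [eta2 * K]. *)
Lemma lagrangian_regret T :
  \sum_(t < T) (Vr pi - Vr (pi_ t) + lambda_ t * (Vg pi - Vg (pi_ t))) <=
  kappa^-1 * (B * G) + (1 + C) * G ^+ 2 + T%:R * (eta2 * K * G ^+ 2).
Proof.
have e1_ge0 : 0 <= eta1 by case: eta1P => [/ltW|[->]].
apply: le_trans (ler_sum _ (fun t _ => lagrangian_step (nat_of_ord t))) _.
rewrite 2!big_split /= -mulr_sumr.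
have telescope (u : nat -> R) : \sum_(t < T) (u t.+1 - u t) = u T - u 0%N.
  by rewrite -(big_mkord xpredT (fun t => u t.+1 - u t)) telescope_sumr.
rewrite (telescope (fun t => V_init M (log_softmax (theta_ t)) pi)).
rewrite (telescope (U (reward M))).
have Ub t := U_bound t (utility_bound M).
have ldiff t : `|lambda_ t.+1 - lambda_ t| <= eta2 * K.
  rewrite lambda_rec; apply: le_trans (proj_itv0_contract _ (lambda_itv t)) _.
  rewrite addrAC subrr sub0r normrN normrM gtr0_norm //.
  by rewrite ler_wpM2l ?violation_le ?ltW.
have l0 t : 0 <= lambda_ t by have /andP[] := lambda_itv t.
have abel := abel_sum_le T l0 Ub ldiff.
have final : lambda_ T * U (utility M) T <= C * G ^+ 2.
  by have /andP[? ?] := lambda_itv T; have /andP[? ?] := Ub T; rewrite ler_pM.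
have /andP[r0 _] := U_bound 0 (reward_bound M).
have /andP[_ rG] := U_bound T (reward_bound M).
have logT : V_init M (log_softmax (theta_ T)) pi <= 0.
  rewrite -(mul0r G) -(V_init_const M 0 ppi); apply: V_init_le => // s a.
  exact: log_softmax_le0.
have log0 : - (B * G) <= V_init M (log_softmax (theta_ 0)) pi.
  rewrite -mulNr -(V_init_const M (- B) ppi); apply: V_init_le => // s a.
  rewrite lerNl; apply: le_trans (ler_norm _) _; rewrite normrN.
  rewrite /B (bigD1 s) //= (bigD1 a) //= -addrA lerDl addr_ge0 ?sumr_ge0 //.
  by move=> i _; rewrite sumr_ge0.
have k0 : 0 <= kappa^-1 by rewrite invr_ge0 divr_ge0 // ltW // discount_gap.
have logk : kappa^-1 * (V_init M (log_softmax (theta_ T)) pi -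
    V_init M (log_softmax (theta_ 0)) pi) <= kappa^-1 * (B * G).
  by rewrite ler_wpM2l // -[leRHS]add0r lerD // lerNl.
apply: le_trans (lerD (lerD logk (lerB rG r0)) abel) _.
by rewrite subr0 -!addrA lerD2l mulrDl mul1r -addrA lerD2l lerD2r.
Qed.

(* At a comparator feasible for bbar, lambda_t * (Vg pi - bbar) >= 0 may be
   dropped; the dual regret then trades lambda_t for a fixed multiplier. *)
Lemma npgpd_regret (lam : R) (T : nat) : bbar <= Vg pi -> 0 <= lam <= C ->
  \sum_(t < T) (Vr pi - Vr (pi_ t) + lam * (bbar - Vg (pi_ t))) <=
  kappa^-1 * (B * G) + (1 + C) * G ^+ 2 + C ^+ 2 / (2 * eta2) +
  T%:R * eta2 * (K * G ^+ 2 + K ^+ 2 / 2).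
Proof.
move=> pi_feasible lam_itv.
have dual := projected_gradient_regret T lam_itv eta2_gt0 lambda_rec violation_le.
have primal := lagrangian_regret T.
have sqC : ((lambda_ 0 - lam) ^+ 2 - (lambda_ T - lam) ^+ 2) / (2 * eta2) <=
    C ^+ 2 / (2 * eta2).
  rewrite ler_wpM2r ?invr_ge0 ?pmulr_rge0 ?(ltW eta2_gt0) //.
  apply: le_trans _ (sqr_diff_le (lambda_itv 0) lam_itv).
  by rewrite gerBl sqr_ge0.
have : \sum_(t < T) (Vr pi - Vr (pi_ t) + lam * (bbar - Vg (pi_ t))) <=
    \sum_(t < T) (Vr pi - Vr (pi_ t) + lambda_ t * (Vg pi - Vg (pi_ t))) +
    \sum_(t < T) (lambda_ t - lam) * (Vg (pi_ t) - bbar).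
  rewrite -big_split /=; apply: ler_sum => t _.
  have /andP[lt0 _] := lambda_itv t.
  have : 0 <= lambda_ t * (Vg pi - bbar) by rewrite mulr_ge0 ?subr_ge0.
  move: (Vr pi) (Vr (pi_ t)) (Vg pi) (Vg (pi_ t)) (lambda_ t) => *; lra.
move=> /le_trans; apply; apply: le_trans (lerD primal (le_trans dual (lerD sqC (lexx _)))) _.
by rewrite le_eqVlt; apply/orP; left; apply/eqP; ring.
Qed.

End Regret.

(** * The averaged iterate *)
Section AverageIterate.
Variables (R : realType) (S A : finType) (M : cmdp R S A).
Variables (xi : R) (theta0 : S -> A -> R) (lambda0 : R).
Hypotheses (xi_gt0 : 0 < xi) (A_gt0 : (0 < #|A|)%N).
Hypothesis lambda0_itv : 0 <= lambda0 <= dual_bound M xi.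
Local Notation gamma := (discount M).
Local Notation Vr := (V_init M (reward M)).
Local Notation Vg := (V_init M (utility M)).

(** The dual step size depends on the horizon, so each [T] has its own run. *)
Definition iterate delta T t :=
  npgpd_policy M xi (offset M + delta) (2 * ln #|A|%:R)
    (2 * (1 - gamma) / Num.sqrt T%:R) theta0 lambda0 t.

Definition iterate_average f delta T : R :=
  T%:R^-1 * \sum_(t < T) V_init M f (iterate delta T t).

Lemma iterate_average_policy delta T : (0 < T)%N ->
  exists pi, is_policy pi /\ forall f, V_init M f pi = iterate_average f delta T.
Proof.
move=> T0; have [|t|pi [ppi piE]] := @policy_mixture _ _ _ M 'I_T
  (fun=> T%:R^-1) (fun t => iterate delta T t).
- split=> [_|]; first by rewrite invr_ge0.
  by rewrite sumr_const card_ord -[LHS]mulr_natr mulVf // pnatr_eq0 -lt0n.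
- exact: npgpd_policyP.
by exists pi; split=> // f; rewrite piE -mulr_sumr.
Qed.

(** After division by [T], an [eta2] of order 1/sqrt T balances the dual distance against the drift;
    the other terms are of order 1/T. The constant is uniform in [delta] because [delta <= xi] keeps
    the shifted offset below 1/(1 - gamma) + xi. *)
Lemma average_regret : exists K : R, 0 < K /\
  forall (delta : R) T pi (lam : R), 0 <= delta <= xi -> (0 < T)%N -> is_policy pi ->
    offset M + delta <= Vg pi -> 0 <= lam <= dual_bound M xi ->
    Vr pi - iterate_average (reward M) delta T +
    lam * (offset M + delta - iterate_average (utility M) delta T) <=
    K / Num.sqrt T%:R.
Proof.
have g1 := discount_gap M; have g1i : 0 < (1 - gamma)^-1 by rewrite invr_gt0.
have C0 : 0 <= dual_bound M xi by case/andP: lambda0_itv; exact: le_trans.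
have ln0 : 0 <= ln #|A|%:R :> R by rewrite ln_ge0 // ler1n.
pose G := (1 - gamma)^-1; pose C := dual_bound M xi; pose N := G + xi.
(* With a single action this inverts 0, which yields 0, and [kB] vanishes. *)
pose kB := (2 * ln #|A|%:R / (1 - gamma))^-1 *
  ((\sum_s \sum_a `|log_softmax theta0 s a|) * G).
pose c := 2 * (1 - gamma).
have kB0 : 0 <= kB.
  rewrite mulr_ge0 ?invr_ge0 ?divr_ge0 ?mulr_ge0 ?(ltW g1) ?(ltW g1i) //.
  by apply: sumr_ge0 => s _; apply: sumr_ge0.
have c0 : 0 < c by rewrite mulr_gt0.
have fix0 : 0 < (1 + C) * G ^+ 2 by rewrite mulr_gt0 ?exprn_gt0 // ltr_pwDl.
have dual0 : 0 <= C ^+ 2 / (2 * c) by rewrite divr_ge0 ?sqr_ge0 // mulr_ge0 // ltW.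
have N0 : 0 < N by rewrite addr_gt0.
have drift0 : 0 <= c * (N * G ^+ 2 + N ^+ 2 / 2).
  apply: mulr_ge0; first exact: ltW.
  by apply: addr_ge0; [apply: mulr_ge0; [exact: ltW | exact: sqr_ge0] | rewrite divr_ge0 ?sqr_ge0].
exists (kB + (1 + C) * G ^+ 2 + C ^+ 2 / (2 * c) + c * (N * G ^+ 2 + N ^+ 2 / 2)).
split=> [|delta T pi lam /andP[d0 dxi] T0 ppi feas lam_itv].
  by rewrite ltr_wpDr // ltr_wpDr // ltr_wpDl.
have T0R : 0 < T%:R :> R by rewrite ltr0n.
set q := Num.sqrt T%:R; have q0 : 0 < q by rewrite sqrtr_gt0.
have qq : q ^+ 2 = T%:R by rewrite sqr_sqrtr // ltW.
have q1 : 1 <= q by rewrite -sqrtr1 ler_wsqrtr // ler1n.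
have eta1P : 0 < 2 * ln #|A|%:R :> R \/ 2 * ln #|A|%:R = 0 :> R /\ #|A| = 1%N.
  move: A_gt0; rewrite leq_eqVlt => /orP[/eqP A1|A2].
    by right; rewrite -A1 ln1 mulr0.
  by left; rewrite mulr_gt0 // ln_gt0 // ltr1n.
have eta2_gt0 : 0 < c / q by rewrite divr_gt0.
have /andP[b0 bG] := offset_bound M.
have bN : 0 <= offset M + delta <= N.
  apply/andP; split; first by rewrite addr_ge0 // ltW.
  by rewrite /N lerD.
have GN : G <= N by rewrite lerDl ltW.
have := npgpd_regret theta0 A_gt0 lambda0_itv ppi eta1P eta2_gt0 bN GN T feas lam_itv.
rewrite -/(iterate delta T) -/kB -/C -/G.
have -> : \sum_(t < T) (Vr pi - Vr (iterate delta T t) +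
    lam * (offset M + delta - Vg (iterate delta T t))) =
    T%:R * (Vr pi - iterate_average (reward M) delta T +
      lam * (offset M + delta - iterate_average (utility M) delta T)).
  rewrite big_split /= -mulr_sumr !sumrB !sumr_const !card_ord /iterate_average.
  rewrite -[_ *+ T]mulr_natl -[(_ + _) *+ T]mulr_natl.
  by field; rewrite lt0r_neq0.
move=> regret; rewrite -(ler_pM2l T0R); apply: le_trans regret _.
rewrite -qq.
have -> : q ^+ 2 * ((kB + (1 + C) * G ^+ 2 + C ^+ 2 / (2 * c) +
    c * (N * G ^+ 2 + N ^+ 2 / 2)) / q) =
  q * (kB + (1 + C) * G ^+ 2) + C ^+ 2 / (2 * (c / q)) +
    q ^+ 2 * (c / q) * (N * G ^+ 2 + N ^+ 2 / 2).
  by field; rewrite !lt0r_neq0.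
(* The dual distance and drift terms agree exactly; [1 <= q] absorbs the fixed ones. *)
by rewrite lerD2r lerD2r ler_peMl // addr_ge0 // ltW.
Qed.

End AverageIterate.

(** * Two-policy mixtures and comparison with the optimal value *)

Section Slater.
Variables (R : realType) (S A : finType) (M : cmdp R S A).

Lemma dist_card_gt0 (X : finType) (p : X -> R) : is_dist p -> (0 < #|X|)%N.
Proof.
move=> [_ p1]; rewrite lt0n; apply/negP => /eqP/card0_eq X0.
by move/eqP: p1; rewrite big_pred0 // eq_sym oner_eq0.
Qed.

Lemma policy_card_gt0 (pi : S -> A -> R) : is_policy pi -> (0 < #|A|)%N.
Proof.
by move=> ppi; have /card_gt0P[s _] := dist_card_gt0 (init_dist M); exact: dist_card_gt0 (ppi s).
Qed.

Lemma policy_mixture2 (alpha : R) (pi1 pi2 : S -> A -> R) :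
  0 <= alpha <= 1 -> is_policy pi1 -> is_policy pi2 ->
  exists pi, is_policy pi /\ forall f,
    V_init M f pi = (1 - alpha) * V_init M f pi1 + alpha * V_init M f pi2.
Proof.
move=> /andP[a0 a1] p1 p2.
have [|b|pi [ppi piE]] := @policy_mixture _ _ _ M bool
  (fun b => if b then 1 - alpha else alpha) (fun b => if b then pi1 else pi2).
- by split=> [[]|]; rewrite ?subr_ge0 // big_bool /= subrK.
- by case: b.
by exists pi; split=> // f; rewrite piE big_bool.
Qed.

Lemma V_reward_bound pi : is_policy pi ->
  0 <= V_init M (reward M) pi <= (1 - discount M)^-1.
Proof. by move=> ppi; apply: V_init_bound => //; exact: reward_bound. Qed.

Lemma reward_le_optimal_value pi : is_policy pi ->
  offset M <= V_init M (utility M) pi -> V_init M (reward M) pi <= optimal_value M.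
Proof.
move=> ppi feas; apply: ub_le_sup; last by exists pi.
by exists (1 - discount M)^-1 => _ [pi' [ppi' _] <-]; case/andP: (V_reward_bound ppi').
Qed.

End Slater.

(** * Feasibility and optimality gap of the averaged iterate *)

Theorem corollary12 (R : realType) (S A : finType) (M : cmdp R S A) (xi : R)
    (theta0 : S -> A -> R) (lambda0 : R) :
  0 < xi -> slater M xi -> 0 <= lambda0 <= dual_bound M xi ->
  exists c1 c2 c3 c4 : R,
    [/\ 0 < c1, 0 < c2, 0 < c3 & 0 < c4] /\
    forall eps : R, 0 < eps -> eps < xi / 2 ->
    exists delta : R,
      [/\ 0 < delta, c1 * eps <= delta, delta <= c2 * eps &
      forall T : nat, (0 < T)%N -> c3 / eps ^+ 2 <= T%:R ->
        let eta1 : R := 2 * ln (#|A|%:R) in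
        let eta2 : R := 2 * (1 - discount M) / Num.sqrt T%:R in
        let pi := npgpd_policy M xi (offset M + delta) eta1 eta2
                    theta0 lambda0 in
        `|T%:R^-1 * \sum_(t < T)
            (optimal_value M - V_init M (reward M) (pi t))| <= c4 * eps /\
        Num.max (T%:R^-1 * \sum_(t < T)
            (offset M - V_init M (utility M) (pi t))) 0 <= 0].
Proof.
move=> xi0 [ps [pps slack]] lambda0_itv.
have [K [K0 regret]] := average_regret theta0 xi0 (policy_card_gt0 M pps) lambda0_itv.
have g1 := discount_gap M.
(* [k * xi] bounds every reward value, and the largest multiplier [2 * k] exceeds the reward loss
   4k/3 per unit of violation met below. *)
have [k [k0 kxi CE]] : exists k : R,
    [/\ 0 < k, k * xi = (1 - discount M)^-1 & dual_bound M xi = 2 * k].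
  exists ((1 - discount M)^-1 / xi).
  split; first by rewrite divr_gt0 ?invr_gt0.
    by rewrite divfK ?gt_eqF.
  by rewrite /dual_bound; field; rewrite !gt_eqF.
have Vr_bound pi : is_policy pi -> 0 <= V_init M (reward M) pi <= k * xi.
  by rewrite kxi; exact: V_reward_bound.
(* The shift is exactly eps/2, whence both halves. The third constant makes the regret at most k
   eps/3, and the gap is then at most k eps/2 + k eps/3 <= k eps. *)
exists (1 / 2), (1 / 2), ((3 * K / k) ^+ 2), k.
have Kk0 : 0 < 3 * K / k by rewrite divr_gt0 ?mulr_gt0.
split; first by split=> //; rewrite exprn_gt0.
move=> eps eps0 eps_xi; exists (eps / 2).
split; [by rewrite divr_gt0 | lra | lra |].
move=> T T0 large /=; rewrite -/(iterate M xi theta0 lambda0 (eps / 2) T).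
have T0R : 0 < T%:R :> R by rewrite ltr0n.
have averageE (c : R) f : T%:R^-1 * \sum_(t < T)
    (c - V_init M f (iterate M xi theta0 lambda0 (eps / 2) T t)) =
    c - iterate_average M xi theta0 lambda0 f (eps / 2) T.
  rewrite sumrB sumr_const card_ord -[c *+ T]mulr_natl mulrBr mulKf //.
  by rewrite gt_eqF.
have [pbar [ppbar pbarE]] :=
  iterate_average_policy M xi theta0 lambda0 (policy_card_gt0 M pps) (eps / 2) T0.
rewrite !averageE -!pbarE.
have err : K / Num.sqrt T%:R <= eps * k / 3.
  have q0 : 0 < Num.sqrt T%:R :> R by rewrite sqrtr_gt0.
  have : 3 * K / k / eps <= Num.sqrt T%:R.
    rewrite -[leLHS]ger0_norm; last by rewrite divr_ge0 // ltW.
    by rewrite -sqrtr_sqr ler_wsqrtr // expr_div_n.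
  rewrite !ler_pdivrMr // => le_q.
  have : 0 <= (Num.sqrt T%:R * eps * k - 3 * K) by rewrite subr_ge0.
  by lra.
have {}regret pi lam : is_policy pi -> offset M + eps / 2 <= V_init M (utility M) pi ->
    0 <= lam <= 2 * k ->
    V_init M (reward M) pi - V_init M (reward M) pbar +
    lam * (offset M + eps / 2 - V_init M (utility M) pbar) <= eps * k / 3.
  move=> ppi feas lam_itv; apply: le_trans err; rewrite !pbarE.
  by apply: regret; rewrite ?CE //; lra.
have /andP[x0 xk] := Vr_bound _ ppbar; have /andP[s0 _] := Vr_bound _ pps.
move: x0 xk s0 slack.
set x := V_init M (reward M) pbar in regret *; set y := V_init M (utility M) pbar in regret *.
set u := V_init M (reward M) ps; set w := V_init M (utility M) ps => x0 xk s0 slack.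
have feasible : offset M <= y.
  have [|y_small] := leP (offset M + eps / 2) y; first lra.
  pose v := offset M + eps / 2 - y; have v0 : 0 < v by rewrite /v; lra.
  (* The Slater slack left after the shift: at least xi - eps/2, and eps < xi/2. *)
  pose s := w - offset M - eps / 2; have s_large : 3 / 4 * xi <= s by rewrite /s; lra.
  have s_gt0 : 0 < s by lra.
  (* With this weight the mixture meets the shifted constraint with equality. At multiplier 2k the
     regret bound gives 2kv <= alpha k xi + k eps/3 <= 4kv/3 + k eps/3, so v <= eps/2. *)
  pose alpha := v / (v + s).
  have alphaE : alpha * (v + s) = v by rewrite /alpha divfK // gt_eqF //; lra.
  have alpha0 : 0 <= alpha by rewrite divr_ge0 //; lra.
  have alpha1 : alpha <= 1 by rewrite ler_pdivrMr; lra.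
  have [|pm [ppm pmE]] := policy_mixture2 M (alpha := alpha) _ ppbar pps.
    by rewrite alpha0.
  have := regret pm (2 * k) ppm; rewrite !pmE -/x -/y -/u -/w.
  have -> : (1 - alpha) * y + alpha * w = offset M + eps / 2.
    by move: alphaE; rewrite /v /s => alphaE; lra.
  rewrite lexx lexx => /(_ isT) /(_ _) reg.
  have {}reg := reg ltac:(lra).
  have au : 0 <= alpha * u by rewrite mulr_ge0.
  have ax : alpha * x <= alpha * (k * xi) by rewrite ler_wpM2l.
  have axi : alpha * xi <= 4 / 3 * v.
    have : alpha * (3 / 4 * xi) <= alpha * s by rewrite ler_wpM2l.
    have : 0 <= alpha * v by rewrite mulr_ge0 // ltW.
    by lra.
  have kaxi : k * (alpha * xi) <= k * (4 / 3 * v) by rewrite ler_wpM2l // ltW.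
  have : k * v <= k * (eps / 2) by rewrite -/v in reg; lra.
  by rewrite ler_pM2l // /v; lra.
split; last by rewrite ge_max lexx subr_le0 feasible.
(* Feasibility of [pbar] makes the gap nonnegative, which removes the absolute value. *)
have le_opt : x <= optimal_value M by exact: reward_le_optimal_value.
rewrite ger0_norm ?subr_ge0 // lerBlDr; apply: ge_sup.
  by exists u; exists ps; split=> //; rewrite -/w; lra.
move=> _ [pi [ppi feas] <-].
(* This share of the Slater policy gains alpha xi = eps/2 of utility, just enough for the shifted
   constraint, and costs at most alpha k xi = k eps/2 of reward. *)
pose alpha := eps / 2 / xi.
have alphaE : alpha * xi = eps / 2 by rewrite /alpha divfK // gt_eqF.
have alpha0 : 0 <= alpha by rewrite !divr_ge0 // ltW.
have alpha1 : alpha <= 1 by rewrite ler_pdivrMr //; lra.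
have [|pm [ppm pmE]] := policy_mixture2 M (alpha := alpha) _ ppi pps.
  by rewrite alpha0.
have /andP[r0 rk] := Vr_bound _ ppi.
have := regret pm 0 ppm; rewrite !pmE -/u -/w mul0r addr0.
have h1 : (1 - alpha) * offset M <= (1 - alpha) * V_init M (utility M) pi.
  by rewrite ler_wpM2l // subr_ge0.
have h2 : alpha * (offset M + xi) <= alpha * w by rewrite ler_wpM2l //; lra.
have h3 : 0 <= alpha * u by rewrite mulr_ge0.
have h4 : alpha * V_init M (reward M) pi <= alpha * (k * xi) by rewrite ler_wpM2l.
have h5 : k * (alpha * xi) = k * (eps / 2) by rewrite alphaE.
move=> reg; have := reg ltac:(lra) ltac:(lra).
have : 0 <= k * eps by rewrite mulr_ge0 // ltW.
by lra.
Qed.
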